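(* For each fixed $s,t\in X_{\mathrm{fin}}$, the process $(M_n(s,t;\cdot))_{n\ge0}$ is a complex-valued $(\mathcal{F}_n)$-martingale on $(\Omega,\mu)$. Moreover, $$\mathbb{E}[M_n(s,t;\cdot)]=K_\infty(s,t)\qquad(n\ge0).$$
   Context: Let $X$ be a set, $m\ge1$ an integer, and $\varphi_1,\dots,\varphi_m:X\to X$ maps. A kernel $J:Y\times Y\to\mathbb{C}$ is positive definite if $\sum_{\alpha,\beta}\overline{c_\alpha}c_\beta J(s_\alpha,s_\beta)\ge0$ for all finite families $(c_\alpha,s_\alpha)\in\mathbb{C}\times Y$; $J_1\le J_2$ means that $J_2-J_1$ is positive definite. The pullback operator is $(LJ)(s,t):=\sum_{i=1}^m J(\varphi_i(s),\varphi_i(t))$. Fix a positive definite kernel $K$ on $X$ with $LK\ge K$. Set $K_0:=K$, $K_{n+1}:=LK_n$, $u_n(s):=K_n(s,s)$ (nondecreasing in $n$), $u_\infty(s):=\lim_nu_n(s)\in[0,\infty]$, $X_{\mathrm{fin}}:=\{s\in X:u_\infty(s)<\infty\}$. Each $\varphi_i$ maps $X_{\mathrm{fin}}$ into itself. For $s,t\in X_{\mathrm{fin}}$ the limit $K_\infty(s,t):=\lim_nK_n(s,t)$ exists; $K_\infty$ is positive definite on $X_{\mathrm{fin}}$ and $LK_\infty=K_\infty$ there. Words: $W_n:=\{1,\dots,m\}^n$, $W_0=\{\emptyset\}$; for $w=i_1\cdots i_n\in W_n$, $\varphi_w:=\varphi_{i_n}\circ\cdots\circ\varphi_{i_1}$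 ($\varphi_\emptyset=\mathrm{id}$). $\Omega:=\{1,\dots,m\}^{\mathbb{N}}$ with product $\sigma$-algebra and product probability measure $\mu$ making the coordinates independent and uniform on $\{1,\dots,m\}$; $\mathbb{E}$ is expectation with respect to $\mu$. For $\omega=\omega_1\omega_2\cdots\in\Omega$, $\omega|n:=\omega_1\cdots\omega_n\in W_n$ ($\omega|0=\emptyset$). $\mathcal{F}_n$ is the $\sigma$-algebra generated by the first $n$ coordinates. For $s,t\in X_{\mathrm{fin}}$, $M_n(s,t;\omega):=m^nK_\infty(\varphi_{\omega|n}(s),\varphi_{\omega|n}(t))$. *)

(* Defs.v *)
From HB Require Import structures.
From mathcomp Require Import all_boot all_order all_algebra.
From mathcomp Require Import finmap complex.
From mathcomp Require Import all_classical all_reals all_analysis.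

Set Implicit Arguments.
Unset Strict Implicit.
Unset Printing Implicit Defensive.

Import Order.TTheory GRing.Theory Num.Theory.
Import numFieldTopology.Exports numFieldNormedType.Exports.

Local Open Scope classical_set_scope.
Local Open Scope ring_scope.
Local Open Scope complex_scope.

Section Kernels.
Context {R : realType} {X : Type}.
Implicit Types J K : X -> X -> R[i].

(* In the order of R[i], 0 <= z means that z is real and nonnegative. *)
Definition posdef J : Prop :=
  forall (n : nat) (c : 'I_n -> R[i]) (s : 'I_n -> X),
    0 <= \sum_(a < n) \sum_(b < n) (c a)^* * c b * J (s a) (s b).

Definition kernel_le J1 J2 : Prop := posdef (fun s t => J2 s t - J1 s t).

Context {m : nat}.
Variable phi : 'I_m -> X -> X.

Definition pullback J : X -> X -> R[i] :=
  fun s t => \sum_(i < m) J (phi i s) (phi i t).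

Definition Kn K (n : nat) : X -> X -> R[i] := iter n pullback K.

(* The diagonal of a positive definite kernel is real, so nothing is lost by
   taking real parts. *)
Definition u_infty K (s : X) : \bar R :=
  limn (fun n => (complex.Re (Kn K n s s))%:E).

Definition Xfin K : set X := [set s | (u_infty K s < +oo)%E].

(* Total function; it is the limit kernel of the text only on Xfin K. *)
Definition K_infty K : X -> X -> R[i] :=
  fun s t => limn (fun n => (Kn K n s t : R[i]^o)).

(* phi_w for w = i_1 ... i_n applies phi_(i_1) first and phi_(i_n) last. *)
Definition phi_word (w : seq 'I_m) (s : X) : X :=
  foldl (fun x i => phi i x) s w.

End Kernels.

Section ComplexProcesses.
Context {R : realType} {d : measure_display} {T : measurableType d}.
Variable mu : {measure set T -> \bar R}.
Implicit Types (f g : T -> R[i]) (G : set (set T)).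

Definition Cborel : set (set R[i]) := <<s [set U : set R[i]^o | open U] >>.

Definition Cmeasurable G f : Prop := forall B, Cborel B -> G (f @^-1` B).

Definition Cintegrable f : Prop :=
  mu.-integrable setT (fun w => (complex.Re (f w))%:E) /\
  mu.-integrable setT (fun w => (complex.Im (f w))%:E).

Definition Cintegral (A : set T) f : R[i] :=
  Rintegral mu A (fun w => complex.Re (f w)) +i*
  Rintegral mu A (fun w => complex.Im (f w)).

Definition Cexpectation f : R[i] := Cintegral setT f.

(* g is a version of the conditional expectation of f given G *)
Definition is_cond_exp G f g : Prop :=
  [/\ Cmeasurable G g, Cintegrable g &
      forall A, G A -> Cintegral A g = Cintegral A f].

Definition filtration (F : nat -> set (set T)) : Prop :=
  forall n, [/\ sigma_algebra setT (F n), F n `<=` measurable &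
                F n `<=` F n.+1].

Definition martingale (F : nat -> set (set T)) (M : nat -> T -> R[i]) : Prop :=
  filtration F /\
  forall n, [/\ Cmeasurable (F n) (M n), Cintegrable (M n) &
                is_cond_exp (F n) (M n.+1) (M n)].

End ComplexProcesses.

(* Sequences over {1,...,m}; w k is the coordinate omega_(k+1).  The argument
   0 < m supplies the base point that a measurableType requires. *)
Definition Omega (m : nat) (hm : (0 < m)%N) : Type := nat -> 'I_m.

Section SequenceSpace.
Context (m : nat) (hm : (0 < m)%N).

HB.instance Definition _ := gen_eqMixin (Omega hm).
HB.instance Definition _ := gen_choiceMixin (Omega hm).
HB.instance Definition _ := isPointed.Build (Omega hm) (fun=> Ordinal hm).


Definition coord_events (D : set nat) : set (set (Omega hm)) :=
  [set A | exists2 k, D k & exists B : set 'I_m, A = [set w | B (w k)]].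

Definition OmegaM := g_sigma_algebraType (coord_events setT).

Definition Fn (n : nat) : set (set OmegaM) := <<s coord_events `I_n >>.

Context {R : realType}.
Variable mu : probability OmegaM R.

Definition coords_independent : Prop :=
  forall (D : {fset nat}) (B : nat -> set 'I_m),
    mu [set w | forall k, k \in D -> B k (w k)] =
    (\prod_(k <- D) mu [set w | B k (w k)])%E.

Definition coords_uniform : Prop :=
  forall (k : nat) (i : 'I_m), mu [set w | w k = i] = (m%:R^-1)%:E.

Definition word_prefix (w : OmegaM) (n : nat) : seq 'I_m := mkseq w n.

Definition Mn {X : Type} (phi : 'I_m -> X -> X) (K : X -> X -> R[i])
    (s t : X) (n : nat) (w : OmegaM) : R[i] :=
  m%:R ^+ n *
    K_infty phi K (phi_word phi (word_prefix w n) s) (phi_word phi (word_prefix w n) t).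

End SequenceSpace.

Arguments Fn {m} hm n _.
Arguments Mn {m} hm {R X} phi K s t n w.

(* Main.v *)
Require Import Defs.
From HB Require Import structures.
From mathcomp Require Import all_boot all_order all_algebra.
From mathcomp Require Import finmap complex.
From mathcomp Require Import all_classical all_reals all_analysis.
From mathcomp Require Import lra.

(** The limit kernel is a fixed point of the pullback on [Xfin]:
    [K_infty s t = \sum_i K_infty (phi_i s) (phi_i t)]. Given the first [n]
    letters of the random word, the next letter is uniform and independent of
    them, so the conditional expectation of [M_(n+1)] is [m ^ n] times the sum
    over [i] of [K_infty] at the [phi_i]-images of the two current points. Those
    points are still in [Xfin], and the fixed point equation turns this sum into
    [M_n]. The constant expectation follows, as [M_0] is the constant
    [K_infty s t].

    The fixed point equation is the limit of [K_(n+1) = L K_n], once the kernels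
    [K_n] are known to converge at every pair of points of [Xfin]
    ([cvg_Kn], [pullback_K_infty]). The pullback preserves positive
    definiteness, so each increment [K_(n+1) - K_n] is positive definite, and the
    off-diagonal values of a positive definite kernel are bounded by its diagonal
    values ([posdef_off_diagonal_le]). The increments at [(s, t)] are therefore
    dominated by those of [u_n(s) + u_n(t)], which is nondecreasing and bounded.

    The measure theory reduces to finite sums. An event of the [n]-th sigma-algebra
    is a condition on the prefix of length [n] ([FnP]), the cylinder over a word
    of length [n] has measure [m ^ -n] ([measure_cylinder]), and so an integral of
    a function of the prefix is its average over all words of length [n]
    ([Cintegral_word_prefix]). The tower property becomes the remark that
    averaging over words of length [n + 1] is averaging over the last letter,
    then over words of length [n] ([Cintegral_word_prefixS]). *)

Set Implicit Arguments.
Unset Strict Implicit.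
Unset Printing Implicit Defensive.
Import Order.TTheory GRing.Theory Num.Theory.
Import numFieldTopology.Exports numFieldNormedType.Exports.
Local Open Scope classical_set_scope.
Local Open Scope ring_scope.

(** * Complex numbers by components *)

Section Complex.
Local Open Scope complex_scope.
Context {R : realType}.
Implicit Types x y : R[i].

Lemma Re_add x y : complex.Re (x + y) = complex.Re x + complex.Re y.
Proof. by case: x => ? ?; case: y. Qed.

Lemma Im_add x y : complex.Im (x + y) = complex.Im x + complex.Im y.
Proof. by case: x => ? ?; case: y. Qed.

Lemma Re_sub x y : complex.Re (x - y) = complex.Re x - complex.Re y.
Proof. by case: x => ? ?; case: y. Qed.

Lemma Im_sub x y : complex.Im (x - y) = complex.Im x - complex.Im y.
Proof. by case: x => ? ?; case: y. Qed.

Lemma Re_sum (I : Type) (r : seq I) (P : pred I) (F : I -> R[i]) :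
  complex.Re (\sum_(i <- r | P i) F i) = \sum_(i <- r | P i) complex.Re (F i).
Proof. exact: (big_morph _ Re_add). Qed.

Lemma Im_sum (I : Type) (r : seq I) (P : pred I) (F : I -> R[i]) :
  complex.Im (\sum_(i <- r | P i) F i) = \sum_(i <- r | P i) complex.Im (F i).
Proof. exact: (big_morph _ Im_add). Qed.

Lemma cvg_real_complex (u : R^nat) (a : R) :
  u @ \oo --> a -> (fun n => (u n)%:C : R[i]^o) @ \oo --> (a%:C : R[i]^o).
Proof.
move=> ua; apply/cvgrPdist_lt => e e0.
(* A positive radius in the order of R[i] is real. *)
have eE : e = (complex.Re e)%:C.
  by case: e e0 => er ei; rewrite ltcE /= => /andP[/eqP -> _].
have e0' : 0 < complex.Re e by rewrite -ltcR -eE.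
move/cvgrPdist_lt : ua => /(_ _ e0'); apply: filterS => n /=.
rewrite -ltcR -eE; congr (_ < _).
by rewrite normc_def /= oppr0 addr0 expr0n /= addr0 sqrtr_sqr.
Qed.

Lemma cvg_complex (u : nat -> R[i]) (a b : R) :
  (fun n => complex.Re (u n)) @ \oo --> a ->
  (fun n => complex.Im (u n)) @ \oo --> b ->
  (u : nat -> R[i]^o) @ \oo --> ((a +i* b) : R[i]^o).
Proof.
move=> /cvg_real_complex ua /cvg_real_complex ub.
pose ra : nat -> R[i]^o := fun n => (complex.Re (u n))%:C.
pose ib : nat -> R[i]^o := fun n => 'i%C * (complex.Im (u n))%:C.
have ibb : ib @ \oo --> ('i%C * b%:C : R[i]^o).
  exact: (@cvgMl_tmp R[i] nat \oo _
    (fun n => (complex.Im (u n))%:C) 'i%C b%:C ub).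
have -> : (u : nat -> R[i]^o) = ra + ib.
  by apply/funext => n; exact: complexE.
rewrite (complexE (a +i* b)).
exact: (@cvgD R[i] R[i]^o nat \oo _ ra ib _ _ ua ibb).
Qed.

End Complex.

(** * Sequences with dominated increments *)

(** Both [d] and [d + r] are nondecreasing and bounded, so their difference [r]
    converges. *)
Lemma cvg_increment_le (R : realType) (d r : R^nat) (M : R) :
  (forall n, `|r n| <= d n) -> (forall n, d n <= M) ->
  (forall n, `|r n.+1 - r n| <= d n.+1 - d n) -> cvgn r.
Proof.
move=> rd dM rdS.
have cd : cvgn d.
  apply: nondecreasing_is_cvgn.
    by apply/nondecreasing_seqP => n; rewrite -subr_ge0 (le_trans _ (rdS n)).
  by exists M => _ [n _ <-].
have cdr : cvgn (d + r).
  apply: nondecreasing_is_cvgn.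
    apply/nondecreasing_seqP => n; rewrite !fctE.
    by have := rdS n; rewrite ler_norml => /andP[? _]; lra.
  exists (M + M) => _ [n _ <-]; rewrite !fctE; apply: lerD => //.
  by rewrite (le_trans (ler_norm _))// (le_trans (rd n)).
have -> : r = d + r - d by apply/funext => n; rewrite !fctE addrC addKr.
exact: is_cvgB.
Qed.

(** * Positive definite kernels and the limit kernel *)

Section Kernels.
Context {R : realType} {X : Type}.
Implicit Types J K : X -> X -> R[i].

Lemma posdef_pair J (e : R[i]) s t : posdef J ->
  0 <= J s s + e * J s t + (conjc e * J t s + conjc e * e * J t t).
Proof.
move=> /(_ 2%N (fun i => if i == ord0 then 1 else e)
              (fun i => if i == ord0 then s else t)).
by rewrite !big_ord_recl !big_ord0 !addr0 !eqxx /= rmorph1 !mul1r !mulr1.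
Qed.

Lemma posdef_diag_ge0 J s : posdef J -> 0 <= complex.Re (J s s).
Proof.
move=> /posdef_pair => /(_ 0 s s); rewrite conjc0 !mul0r !addr0.
by rewrite lecE => /andP[].
Qed.

(** Polarization: the quadratic form at the coefficients [(1, e)] with
    [e = 1, -1] bounds the real part of [J s t], and with [e = 'i, - 'i] its
    imaginary part. That the form is real for these [e] also yields
    [J t s = conjc (J s t)], which the estimates use. *)
Lemma posdef_off_diagonal_le J s t : posdef J ->
  let d := complex.Re (J s s) + complex.Re (J t t) in
  `|complex.Re (J s t)| <= d /\ `|complex.Im (J s t)| <= d.
Proof.
move=> Jpd; have h e := @posdef_pair J e s t Jpd.
have := h 'i%C; have := h (- 'i%C); have := h 1; have := h (-1).
have := @posdef_pair J 0 s s Jpd; have := @posdef_pair J 0 t t Jpd.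
case: (J s s) => ? ?; case: (J s t) => ? ?.
case: (J t s) => ? ?; case: (J t t) => ? ?.
rewrite !lecE /=; do 6 ! (move=> /andP[/eqP ? ?]).
by rewrite !ler_norml; split; apply/andP; split; lra.
Qed.

Context {m : nat}.
Variable phi : 'I_m -> X -> X.

Lemma posdef_pullback J : posdef J -> posdef (pullback phi J).
Proof.
move=> Jpd n c s.
have -> : \sum_(a < n) \sum_(b < n) (c a)^* * c b * pullback phi J (s a) (s b)
  = \sum_(i < m) \sum_(a < n) \sum_(b < n)
      (c a)^* * c b * J (phi i (s a)) (phi i (s b)).
  rewrite [RHS]exchange_big; apply: eq_bigr => a _.
  rewrite [RHS]exchange_big; apply: eq_bigr => b _.
  by rewrite /pullback mulr_sumr.
by apply: sumr_ge0 => i _; exact: Jpd.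
Qed.

Lemma kernel_le_pullback J1 J2 : kernel_le J1 J2 ->
  kernel_le (pullback phi J1) (pullback phi J2).
Proof.
move=> /posdef_pullback; congr posdef.
by apply/funext => s; apply/funext => t; rewrite /pullback sumrB.
Qed.

Section Iterates.
Variable K : X -> X -> R[i].
Hypotheses (K_pd : posdef K) (LK_ge : kernel_le K (pullback phi K)).

Let u n s := complex.Re (Kn phi K n s s).

Lemma KnS n s t :
  Kn phi K n.+1 s t = \sum_(i < m) Kn phi K n (phi i s) (phi i t).
Proof. by []. Qed.

Lemma posdef_Kn n : posdef (Kn phi K n).
Proof. by elim: n => //= n; exact: posdef_pullback. Qed.

Lemma Kn_le n : kernel_le (Kn phi K n) (Kn phi K n.+1).
Proof. by elim: n => //= n; exact: kernel_le_pullback. Qed.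

Lemma Kn_diag_nondecreasing s : nondecreasing_seq (u ^~ s).
Proof.
apply/nondecreasing_seqP => n; rewrite -subr_ge0 -Re_sub.
exact: (@posdef_diag_ge0 _ s (@Kn_le n)).
Qed.

Lemma Xfin_bounded s : Xfin phi K s <-> exists M, forall n, u n s <= M.
Proof.
have nd : nondecreasing_seq (fun n => (u n s)%:E).
  by move=> a b ab; rewrite lee_fin (@Kn_diag_nondecreasing s).
rewrite /Xfin /u_infty /=; split.
  rewrite (cvg_lim _ (ereal_nondecreasing_cvgn nd))// => fin.
  exists (fine (ereal_sup (range (fun n => (u n s)%:E)))) => n.
  have le k : ((u k s)%:E <= ereal_sup (range (fun n => (u n s)%:E)))%E.
    by apply: ereal_sup_ubound; exists k.
  rewrite -lee_fin fineK// fin_numElt fin andbT.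
  by rewrite (lt_le_trans _ (le 0%N)) ?ltNyr.
move=> [M uM]; apply: (@le_lt_trans _ _ M%:E); last exact: ltry.
apply: lime_le; first exact: ereal_nondecreasing_is_cvgn.
by apply: nearW => n; rewrite lee_fin; exact: uM.
Qed.

(** [u_(n+1)(s)] is the sum of the nonnegative numbers [u_n(phi_i s)]. *)
Lemma Xfin_phi i s : Xfin phi K s -> Xfin phi K (phi i s).
Proof.
move=> /Xfin_bounded[M uM]; apply/Xfin_bounded; exists M => n.
apply: le_trans (uM n.+1); rewrite /u KnS Re_sum (bigD1 i)//= lerDl.
by apply: sumr_ge0 => j _; exact/posdef_diag_ge0/posdef_Kn.
Qed.

Lemma Xfin_phi_word w s : Xfin phi K s -> Xfin phi K (phi_word phi w s).
Proof. by elim: w s => //= i w IHw s hs; exact/IHw/Xfin_phi. Qed.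

(** The off-diagonal bound is used twice: for [K_n] itself, and for the positive
    definite increment [K_(n+1) - K_n], whose diagonal values are the increments
    of the bounded sequence [u_n(s) + u_n(t)]. *)
Lemma cvg_Kn s t : Xfin phi K s -> Xfin phi K t ->
  (fun n => (Kn phi K n s t : R[i]^o)) @ \oo --> (K_infty phi K s t : R[i]^o).
Proof.
move=> /Xfin_bounded[Ms uMs] /Xfin_bounded[Mt uMt].
pose d n := u n s + u n t.
have dM n : d n <= Ms + Mt by apply: lerD.
have bound n := posdef_off_diagonal_le s t (@posdef_Kn n).
have boundS n := posdef_off_diagonal_le s t (@Kn_le n).
have dS n : d n.+1 - d n = u n.+1 s - u n s + (u n.+1 t - u n t).
  by rewrite /d opprD addrACA.
have cRe : cvgn (fun n => complex.Re (Kn phi K n s t)).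
  apply: (cvg_increment_le _ dM) => n; first by have [] := bound n.
  by have [+ _] := boundS n; rewrite !Re_sub dS.
have cIm : cvgn (fun n => complex.Im (Kn phi K n s t)).
  apply: (cvg_increment_le _ dM) => n; first by have [] := bound n.
  by have [_] := boundS n; rewrite Im_sub !Re_sub dS.
have h := cvg_complex cRe cIm.
by rewrite /K_infty (cvg_lim _ h).
Qed.

(** Both sides are limits of [K_(n+1)(s, t)]. *)
Lemma pullback_K_infty s t : Xfin phi K s -> Xfin phi K t ->
  pullback phi (K_infty phi K) s t = K_infty phi K s t.
Proof.
move=> hs ht.
have h1 : (fun n => (Kn phi K n.+1 s t : R[i]^o)) @ \oo -->
    (K_infty phi K s t : R[i]^o).
  by have := cvg_Kn hs ht; rewrite -(cvg_shiftS).
have h2 : (fun n => (Kn phi K n.+1 s t : R[i]^o)) @ \oo -->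
    (pullback phi (K_infty phi K) s t : R[i]^o).
  apply: (@cvg_big R[i]^o 'I_m +%R 0 xpredT (@add_continuous R[i]^o)
    nat \oo (index_enum 'I_m)
    (fun i n => Kn phi K n (phi i s) (phi i t))
    (fun i => K_infty phi K (phi i s) (phi i t))) => i _.
  by apply: cvg_Kn; exact: Xfin_phi.
exact: (cvg_unique _ h2 h1).
Qed.

End Iterates.
End Kernels.

(** * Events determined by a finite prefix *)

Section Prefixes.
Context {m : nat} {hm : (0 < m)%N}.
Implicit Types w : OmegaM hm.

Lemma word_prefixS w n : word_prefix w n.+1 = rcons (word_prefix w n) (w n).
Proof. exact: mkseqS. Qed.

Lemma size_word_prefix w n : size (word_prefix w n) == n.
Proof. by rewrite size_mkseq. Qed.

Lemma coord_eventsS (D E : set nat) : D `<=` E ->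
  @coord_events m hm D `<=` @coord_events m hm E.
Proof. by move=> DE A [k Dk BA]; exists k => //; exact: DE. Qed.

Lemma Fn_filtration : filtration (Fn hm).
Proof.
move=> n; split; first exact: smallest_sigma_algebra.
- by apply: sub_sigma_algebra2; exact: coord_eventsS.
- by apply: sub_sigma_algebra2; apply: coord_eventsS => k /=; exact: ltnW.
Qed.

(** Arbitrary conditions [P] are allowed because the alphabet is finite: splitting
    according to the last letter writes the event as a finite union. *)
Lemma Fn_word_prefix n (P : set (seq 'I_m)) :
  Fn hm n [set w | P (word_prefix w n)].
Proof.
elim: n P => [|n IHn] P.
  pose G := g_sigma_algebraType (@coord_events m hm `I_0).
  have [P0|P0] := pselect (P [::]).
    rewrite [X in Fn hm 0 X](_ : _ = [set: G]); last by apply/seteqP; split.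
    exact: (@measurableT _ G).
  rewrite [X in Fn hm 0 X](_ : _ = set0); last by apply/seteqP; split.
  exact: (@measurable0 _ G).
pose G := g_sigma_algebraType (@coord_events m hm `I_n.+1).
have -> : [set w : OmegaM hm | P (word_prefix w n.+1)] =
    \bigcup_(i in [set: 'I_m])
      ([set w | P (rcons (word_prefix w n) i)] `&` [set w | w n = i]).
  apply/seteqP; split => w /=.
    by rewrite word_prefixS => Pw; exists (w n).
  by move=> [k _] /=; rewrite word_prefixS => -[Pk ->].
apply: (@fin_bigcup_measurable _ G) => [|i _]; first exact: finite_finset.
apply: (@measurableI _ G).
  have [_ _] := Fn_filtration n; apply.
  exact: (IHn (fun v => P (rcons v i))).
by apply: sub_sigma_algebra; exists n => /=; [|exists [set i]].
Qed.

(** The sets that cannot separate two sequences with the same prefix form a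
    sigma-algebra containing the generators. *)
Lemma Fn_saturated n (A : set (OmegaM hm)) : Fn hm n A ->
  forall w w', word_prefix w n = word_prefix w' n -> A w -> A w'.
Proof.
pose S := [set A : set (OmegaM hm) |
  forall w w', word_prefix w n = word_prefix w' n -> A w -> A w'].
suff : Fn hm n `<=` S by move=> FS /FS.
apply: smallest_sub.
  split => [w w' _ []|B SB w w' ww' [_ Bw]|B SB w w' ww' [k _ Bkw]].
    by split=> // Bw'; apply: Bw; exact: SB (esym ww') Bw'.
  by exists k => //; exact: SB ww' Bkw.
move=> _ [k kn [B ->]] w w' ww' /=.
suff -> : w k = w' k by [].
have /(congr1 (fun v => nth (w k) v k)) := ww'.
by rewrite !nth_mkseq.
Qed.

Lemma FnP n (A : set (OmegaM hm)) : Fn hm n A <->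
  exists P : set (seq 'I_m), A = [set w | P (word_prefix w n)].
Proof.
split=> [FA|[P ->]]; last exact: Fn_word_prefix.
exists [set v | exists2 w, A w & word_prefix w n = v].
apply/seteqP; split => [w Aw|w [w' Aw' /= ww']]; first by exists w.
exact: Fn_saturated FA _ _ ww' Aw'.
Qed.

Lemma measurable_word_prefix n (P : set (seq 'I_m)) :
  measurable [set w : OmegaM hm | P (word_prefix w n)].
Proof. by have [_ + _] := Fn_filtration n; apply; exact: Fn_word_prefix. Qed.

Lemma Cmeasurable_word_prefix (R : realType) n (f : seq 'I_m -> R[i]) :
  Cmeasurable (Fn hm n) (fun w : OmegaM hm => f (word_prefix w n)).
Proof. by move=> B _; exact: (@Fn_word_prefix _ (fun v => B (f v))). Qed.

End Prefixes.

(** * Integrals of functions of a finite prefix *)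

Lemma big_tuple_rcons (m : nat) (V : nmodType) n (f : seq 'I_m -> V) :
  \sum_(v : n.+1.-tuple 'I_m) f v =
  \sum_(v : n.-tuple 'I_m) \sum_(i < m) f (rcons v i).
Proof.
pose h (p : n.-tuple 'I_m * 'I_m) := [tuple of rcons p.1 p.2].
have h_bij : bijective h.
  apply: inj_card_bij => [[v i] [v' i'] /(congr1 val) /= /rcons_inj[vv' ->]|].
    by congr pair; exact: val_inj.
  by rewrite card_prod !card_tuple !card_ord expnSr.
by rewrite pair_bigA (reindex h)//; exact: onW_bij.
Qed.

Section Integration.
Context {R : realType} {m : nat} {hm : (0 < m)%N}.
Variable mu : probability (OmegaM hm) R.

Lemma prefix_indicE n (f : seq 'I_m -> R) (w : OmegaM hm) :
  f (word_prefix w n) =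
  \sum_(v : n.-tuple 'I_m) f v * \1_[set w : OmegaM hm | word_prefix w n = v] w.
Proof.
rewrite (bigD1 (Tuple (size_word_prefix w n)))//= indicE mem_set// mulr1.
rewrite big1 ?addr0// => v vw; rewrite indicE memNset ?mulr0// => /= wv.
by move/eqP: vw; apply; apply: val_inj.
Qed.

Lemma measurable_cylinder n (v : n.-tuple 'I_m) :
  measurable [set w : OmegaM hm | word_prefix w n = v].
Proof. exact: (measurable_word_prefix _ [set x : seq 'I_m | x = v]). Qed.

Lemma integrable_word_prefix n (f : seq 'I_m -> R) :
  mu.-integrable setT (fun w : OmegaM hm => (f (word_prefix w n))%:E).
Proof.
under eq_fun do rewrite prefix_indicE -sumEFin.
apply: integrable_sum => // v _; under eq_fun do rewrite EFinM.
apply: integrableZl => //.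
by apply: integrable_indic; exact: measurable_cylinder.
Qed.

Hypotheses (mu_indep : coords_independent mu) (mu_unif : coords_uniform mu).

Lemma measure_cylinder n (v : n.-tuple 'I_m) :
  mu [set w : OmegaM hm | word_prefix w n = v] = (m%:R ^- n)%:E.
Proof.
pose D := seq_fset tt (iota 0 n).
pose a k := nth (Ordinal hm) v k.
have -> : [set w : OmegaM hm | word_prefix w n = v] =
    [set w : OmegaM hm | forall k, k \in D -> [set a k] (w k)].
  apply/seteqP; split => w /=.
    move=> wv k; rewrite seq_fsetE mem_iota add0n => /andP[_ kn].
    by rewrite /a -wv nth_mkseq.
  move=> wD; apply: (@eq_from_nth _ (Ordinal hm)).
    by rewrite size_tuple size_mkseq.
  move=> k; rewrite size_mkseq => kn; rewrite nth_mkseq//; apply: wD.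
  by rewrite seq_fsetE mem_iota add0n.
rewrite (mu_indep D (fun k => [set a k])) (eq_bigr (fun=> (m%:R^-1)%:E)).
  rewrite -(big_morph EFin EFinM erefl) big_const_seq count_predT size_seq_fset.
  by rewrite undup_id ?iota_uniq// size_iota iter_mulr_1 exprVn.
by move=> k _; exact: mu_unif.
Qed.

Lemma Rintegral_word_prefix n (f : seq 'I_m -> R) :
  Rintegral mu setT (fun w : OmegaM hm => f (word_prefix w n)) =
  m%:R ^- n * \sum_(v : n.-tuple 'I_m) f v.
Proof.
have mC := @measurable_cylinder n.
rewrite /Rintegral; under eq_integral do rewrite prefix_indicE -sumEFin.
rewrite integral_sum//; last first.
  move=> v; under eq_fun do rewrite EFinM.
  by apply: integrableZl => //; exact: integrable_indic.
rewrite (eq_bigr (fun v : n.-tuple 'I_m => (m%:R ^- n * f v)%:E)).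
  by rewrite sumEFin /= mulr_sumr.
move=> v _; under eq_integral do rewrite EFinM.
rewrite integralZl//; last exact: integrable_indic.
rewrite integral_indic// setIT [RHS]EFinM muleC.
by congr (_ * _)%E; exact: measure_cylinder.
Qed.

Lemma Cintegral_word_prefix n (P : set (seq 'I_m)) (f : seq 'I_m -> R[i]) :
  Cintegral mu [set w : OmegaM hm | P (word_prefix w n)]
    (fun w : OmegaM hm => f (word_prefix w n)) =
  m%:R ^- n * \sum_(v : n.-tuple 'I_m) (if `[< P v >] then f v else 0).
Proof.
have patchE (g : R[i] -> R) : g 0 = 0 ->
    Rintegral mu [set w : OmegaM hm | P (word_prefix w n)]
      (fun w : OmegaM hm => g (f (word_prefix w n)))
    = m%:R ^- n * \sum_(v : n.-tuple 'I_m) g (if `[< P v >] then f v else 0).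
  move=> g0; rewrite Rintegral_mkcond.
  rewrite -(Rintegral_word_prefix n
    (fun v => g (if `[< P v >] then f v else 0))).
  apply: eq_Rintegral => w _; rewrite patchE /=.
  case: asboolP => Pw; first by rewrite mem_set.
  by rewrite memNset.
rewrite /Cintegral !patchE// -Re_sum -Im_sum.
have -> : (m%:R ^- n : R[i]) = real_complex R (m%:R ^- n).
  by rewrite fmorphV rmorphXn rmorph_nat.
case: (\sum_(v : n.-tuple 'I_m) _) => x y /=.
by apply/eqP; rewrite eq_complex /= !mul0r subr0 addr0 !eqxx.
Qed.

(** The conditional expectation of a function of the first [n + 1] letters given
    the first [n]: average over the last letter. *)
Lemma Cintegral_word_prefixS n (f : seq 'I_m -> R[i]) A : Fn hm n A ->
  Cintegral mu A (fun w : OmegaM hm => f (word_prefix w n.+1)) =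
  Cintegral mu A (fun w : OmegaM hm =>
    m%:R^-1 * \sum_(i < m) f (rcons (word_prefix w n) i)).
Proof.
move=> /FnP[P ->].
rewrite (Cintegral_word_prefix n P
  (fun v => m%:R^-1 * \sum_(i < m) f (rcons v i))).
(* The same event, read as a condition on the prefix of length n + 1. *)
have -> : [set w : OmegaM hm | P (word_prefix w n)] =
    [set w | P (take n (word_prefix w n.+1))].
  apply/funext => w /=; rewrite word_prefixS -cats1 take_size_cat//.
  exact/eqP/size_word_prefix.
rewrite (Cintegral_word_prefix n.+1 (fun v => P (take n v))).
rewrite (big_tuple_rcons _ (fun v => if `[< P (take n v) >] then f v else 0)).
rewrite exprSr invfM -mulrA mulr_sumr; congr (_ * _); apply: eq_bigr => v _.
rewrite (eq_bigr (fun i => if `[< P v >] then f (rcons v i) else 0)); last first.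
  by move=> i _; rewrite -cats1 take_size_cat ?size_tuple.
by case: asboolP => _ //; rewrite big1 ?mulr0.
Qed.

End Integration.

(** * The martingale *)

Theorem lemma5p1 (R : realType) (X : Type) (m : nat) (hm : (0 < m)%N)
    (phi : 'I_m -> X -> X) (K : X -> X -> R[i])
    (K_pd : posdef K) (LK_ge : kernel_le K (pullback phi K))
    (mu : probability (OmegaM hm) R)
    (mu_indep : coords_independent mu) (mu_unif : coords_uniform mu)
    (s t : X) (hs : Xfin phi K s) (ht : Xfin phi K t) :
  martingale mu (Fn hm) (Mn hm phi K s t) /\
  (forall n : nat,
     Cexpectation mu (Mn hm phi K s t n) = K_infty phi K s t).
Proof.
pose g n v : R[i] := m%:R ^+ n * K_infty phi K (phi_word phi v s) (phi_word phi v t).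
have m0 : m%:R != 0 :> R[i] by rewrite pnatr_eq0 -lt0n.
(* The fixed point equation, applied at the points reached after reading v. *)
have g_avg n v : m%:R^-1 * \sum_(i < m) g n.+1 (rcons v i) = g n v.
  rewrite /g -mulr_sumr exprS !mulrA mulVf// mul1r; congr (_ * _).
  rewrite -(pullback_K_infty K_pd LK_ge); [|exact: Xfin_phi_word..].
  by apply: eq_bigr => i _; rewrite /phi_word !foldl_rcons.
have intM n : Cintegrable mu (Mn hm phi K s t n).
  by split; [exact: (integrable_word_prefix mu n (fun v => complex.Re (g n v)))
            |exact: (integrable_word_prefix mu n (fun v => complex.Im (g n v)))].
have condM n A : Fn hm n A ->
    Cintegral mu A (Mn hm phi K s t n) = Cintegral mu A (Mn hm phi K s t n.+1).
  move=> FA; rewrite [RHS](Cintegral_word_prefixS mu_indep mu_unif (g n.+1) FA).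
  by congr Cintegral; apply/funext => w; rewrite g_avg.
split.
  split; first exact: Fn_filtration.
  have adM n : Cmeasurable (Fn hm n) (Mn hm phi K s t n).
    exact: (@Cmeasurable_word_prefix m hm R n (g n)).
  by move=> n; split => //; split => //; exact: condM.
elim=> [|n <-].
  rewrite /Cexpectation /Cintegral.
  have E (h : R[i] -> R) :
      Rintegral mu setT (fun w => h (Mn hm phi K s t 0%N w)) = h (K_infty phi K s t).
    have -> : (fun w => h (Mn hm phi K s t 0%N w)) = cst (h (K_infty phi K s t)).
      by apply/funext => w; rewrite /Mn expr0 mul1r.
    by rewrite Rintegral_cst//= probability_setT mulr1.
  by rewrite !E; case: K_infty.
by rewrite /Cexpectation -condM//; exact: (@Fn_word_prefix _ _ _ setT).
Qed.
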